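(* Let $R$ be a commutative ring, $N=\mathrm{N}_3(R)$ and $M=\mathrm{M}_3(R)$. Then $H^n(N,M/N)$ is a free $R$-module for all $n\ge0$, with $\mathrm{rank}_R H^0(N,M/N)=2$ and $\mathrm{rank}_RH^n(N,M/N)=n+1$ for $n\ge1$.
   Context: $\mathrm{N}_3(R)=\left\{\begin{pmatrix}a&b&c\\0&a&d\\0&0&a\end{pmatrix}\mid a,b,c,d\in R\right\}\subseteq\mathrm{M}_3(R)$. $H^n$ is Hochschild cohomology, with $M/N$ an $N$-bimodule via matrix multiplication. *)

(* Defs.v *)
From HB Require Import structures.
From mathcomp Require Import all_boot all_order all_algebra.
Set Implicit Arguments. Unset Strict Implicit. Unset Printing Implicit Defensive.
Import Order.TTheory GRing.Theory Num.Theory.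
Local Open Scope ring_scope.

Section Hochschild.
Variable R : comPzRingType.

Definition nmat (a b c d : R) : 'M[R]_3 :=
  \matrix_(i < 3, j < 3)
    match nat_of_ord i, nat_of_ord j with
    | 0, 0 | 1, 1 | 2, 2 => a
    | 0, 1 => b
    | 0, 2 => c
    | 1, 2 => d
    | _, _ => 0
    end.

Definition inN (x : 'M[R]_3) : Prop := exists a b c d, x = nmat a b c d.

(* n-cochains with values in M/N, represented by (set-theoretic) lifts to M;
   only the values on N^n matter, and only modulo N. *)
Definition cochain (n : nat) := ('I_n -> 'M[R]_3) -> 'M[R]_3.

Definition allN n (v : 'I_n -> 'M[R]_3) : Prop := forall i, inN (v i).

Definition upd n (v : 'I_n -> 'M[R]_3) (i : 'I_n) (x : 'M[R]_3) : 'I_n -> 'M[R]_3 :=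
  fun j => if j == i then x else v j.

Definition multilinear n (f : cochain n) : Prop :=
  forall (v : 'I_n -> 'M[R]_3) (i : 'I_n) (x y : 'M[R]_3) (r : R),
    allN v -> inN x -> inN y ->
    inN (f (upd v i (r *: x + y)) - (r *: f (upd v i x) + f (upd v i y))).

Definition merge n (v : 'I_n.+1 -> 'M[R]_3) (k : nat) : 'I_n -> 'M[R]_3 :=
  fun j => if (j < k)%N then v (widen_ord (leqnSn n) j)
           else if (nat_of_ord j == k) then v (widen_ord (leqnSn n) j) *m v (lift ord0 j)
           else v (lift ord0 j).

Definition hoch_d n (f : cochain n) : cochain n.+1 :=
  fun v =>
    v ord0 *m f (fun j => v (lift ord0 j))
    + \sum_(k < n) ((-1) ^+ k.+1) *: f (merge v k)
    + ((-1) ^+ n.+1) *: (f (fun j => v (widen_ord (leqnSn n) j)) *m v ord_max).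

Definition cocycle n (f : cochain n) : Prop :=
  multilinear f /\ forall v, allN v -> inN (hoch_d f v).

Definition coboundary (n : nat) : cochain n -> Prop :=
  match n return cochain n -> Prop with
  | 0 => fun f => forall v, allN v -> inN (f v)
  | m.+1 => fun f => exists g : cochain m, multilinear g /\
               forall v, allN v -> inN (f v - hoch_d g v)
  end.

Definition HH_free_of_rank (n k : nat) : Prop :=
  exists c : 'I_k -> cochain n,
    (forall i, cocycle (c i)) /\
    (forall z : cochain n, cocycle z ->
       exists r : 'I_k -> R, coboundary (fun v => z v - \sum_(i < k) r i *: c i v)) /\
    (forall r : 'I_k -> R, coboundary (fun v => \sum_(i < k) r i *: c i v) ->
       forall i, r i = 0).

End Hochschild.

(* Main.v *)
From HB Require Import structures.
From Stdlib Require Import FunctionalExtensionality.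
From mathcomp Require Import all_boot all_order all_algebra ring zify.
Require Import Defs.
Set Implicit Arguments. Unset Strict Implicit. Unset Printing Implicit Defensive.
Import GRing.Theory.
Local Open Scope ring_scope.

(** N is the quadratic monomial algebra R<x, y>/(x^2, y^2, yx), with x = E12,
    y = E23 and xy = E13.  It is Koszul: the cohomology of a bimodule V is that
    of the complex of functions on the words y^i x^j, i + j = n, all of whose
    length-two subwords are relations.  For the bar complex this amounts to:
    a cocycle vanishing on these words is a coboundary.  That is proved by
    induction on the degree, after correcting the cocycle so that it vanishes
    on all words whose tail is Koszul, by currying the first argument, which
    replaces V by Hom(N, V) and lowers the degree by one.  On V = M/N, which is
    free of rank 5, the Koszul complex is then computed by hand; its classes are
    represented by the cochains dual to y^i x^(n-i), with diagonal values. *)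

(** * Word cochains of the monomial algebra *)

(** [(a, b)] stands for the basis element x^a y^b of N. *)
Definition letter := (bool * bool)%type.
Notation l1 := ((false, false) : letter).
Notation lx := ((true, false) : letter).
Notation ly := ((false, true) : letter).
Notation lz := ((true, true) : letter).

(** [None] is the zero product; the three clauses come from the relations x^2, y^2 and yx. *)
Definition lmul (a b : letter) : option letter :=
  if [|| a.1 && b.1, a.2 && b.2 | a.2 && b.1] then None
  else Some (a.1 || b.1, a.2 || b.2).

Definition koszul (w : seq letter) :=
  all (fun a => a.1 (+) a.2) w && sorted (fun a b => lmul a b == None) w.

Lemma koszul_cons a w : koszul (a :: w) -> koszul w.
Proof.
by move=> /andP[/= /andP[_ Hw] Hp]; rewrite /koszul Hw (path_sorted Hp).
Qed.

Lemma koszul_rcons a w : koszul (rcons w a) -> koszul w.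
Proof.
rewrite /koszul all_rcons => /andP[/andP[_ ->]] /=.
by rewrite -cats1 => /cat_sorted2[].
Qed.

Lemma koszul_y w : koszul (ly :: w) = koszul w.
Proof.
rewrite /koszul /=; case: w => //= -[a1 a2] w.
by case: a1; case: a2; rewrite //= ?andbF.
Qed.

Section WordCochains.
Variable V : zmodType.

Definition extend (phi : letter -> V) (a : option letter) : V := oapp phi 0 a.

Lemma eq_extend phi psi p : phi =1 psi -> extend phi p = extend psi p.
Proof. by case: p => /=. Qed.

(* All terms of the Hochschild differential but the first; the recursion fixes the
   first letter, which flips the remaining signs. *)
Fixpoint inner (ra : letter -> V -> V) (f : seq letter -> V) (w : seq letter) {struct w} : V :=
  match w with
  | [::] => 0
  | a :: w' =>
    match w' with
    | [::] => - ra a (f [::])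
    | b :: t => - extend (fun c => f (c :: t)) (lmul a b)
                - inner ra (fun u => f (a :: u)) w'
    end
  end.

Arguments inner : simpl never.

Definition wd (la ra : letter -> V -> V) (f : seq letter -> V) (w : seq letter) : V :=
  if w is a :: w' then la a (f w') + inner ra f w else 0.

(* The left action is not required to be unital: currying does not preserve
   unitality. *)
Record bimodule (la ra : letter -> V -> V) : Prop := Bimodule {
  laB : forall a u v, la a (u - v) = la a u - la a v;
  raB : forall a u v, ra a (u - v) = ra a u - ra a v;
  laA : forall a b v, la a (la b v) = extend (la^~ v) (lmul a b);
  raA : forall a b v, ra b (ra a v) = extend (ra^~ v) (lmul a b);
  laraA : forall a b v, la a (ra b v) = ra b (la a v);
  ra1 : forall v, ra l1 v = v
}.

Variables (la ra : letter -> V -> V).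
Hypothesis bV : bimodule la ra.

Local Notation I := (inner ra).
Local Notation d := (wd la ra).

Lemma la0 a : la a 0 = 0.
Proof. by have := laB bV a 0 0; rewrite !subrr. Qed.

Lemma ra0 a : ra a 0 = 0.
Proof. by have := raB bV a 0 0; rewrite !subrr. Qed.

Lemma laN a v : la a (- v) = - la a v.
Proof. by rewrite -[- v]sub0r (laB bV) la0 sub0r. Qed.

Lemma raN a v : ra a (- v) = - ra a v.
Proof. by rewrite -[- v]sub0r (raB bV) ra0 sub0r. Qed.

Lemma laD a u v : la a (u + v) = la a u + la a v.
Proof. by rewrite -{1}[v]opprK (laB bV) laN opprK. Qed.

Lemma la_extend a phi b : la a (extend phi b) = extend (fun c => la a (phi c)) b.
Proof. by case: b => //=; rewrite la0. Qed.

Lemma inner_cons f a b t :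
  I f [:: a, b & t] =
  - extend (fun c => f (c :: t)) (lmul a b) - I (fun u => f (a :: u)) (b :: t).
Proof. by []. Qed.

Lemma inner1 f a : I f [:: a] = - ra a (f [::]).
Proof. by []. Qed.

Lemma eq_inner f g w : (forall u, size u = (size w).-1 -> f u = g u) ->
  I f w = I g w.
Proof.
elim: w f g => [|a [|b t] IH] f g fg //; first by rewrite !inner1 fg.
rewrite !inner_cons; congr (- _ - _).
  by case: (lmul a b) => [c|//] /=; rewrite fg.
by apply: IH => u Hu; rewrite fg //= Hu.
Qed.

Lemma eq_wd f g w : (forall u, size u = (size w).-1 -> f u = g u) ->
  d f w = d g w.
Proof. by case: w => [//|a w] fg; rewrite /wd (eq_inner fg) fg. Qed.

Lemma innerB f g w : I (fun u => f u - g u) w = I f w - I g w.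
Proof.
elim: w f g => [|a [|b t] IH] f g; first by rewrite subrr.
  by rewrite !inner1 (raB bV) opprB opprK addrC.
rewrite !inner_cons IH.
have ->: extend (fun c => f (c :: t) - g (c :: t)) (lmul a b) =
  extend (fun c => f (c :: t)) (lmul a b) - extend (fun c => g (c :: t)) (lmul a b).
  by case: (lmul a b) => [c|] //=; rewrite subr0.
by rewrite !opprD !opprK addrACA.
Qed.

Lemma inner0 w : I (fun=> 0) w = 0.
Proof. by have := innerB (fun=> 0) (fun=> 0) w; rewrite !subrr. Qed.

Lemma innerN f w : I (fun u => - f u) w = - I f w.
Proof.
have := innerB (fun=> 0) f w; rewrite inner0 sub0r => <-.
by apply: eq_inner => u _; rewrite sub0r.
Qed.

Lemma innerD f g w : I (fun u => f u + g u) w = I f w + I g w.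
Proof.
by rewrite -[I g w]opprK -innerN -innerB; apply: eq_inner => u _; rewrite opprK.
Qed.

Lemma wdB f g w : d (fun u => f u - g u) w = d f w - d g w.
Proof.
case: w => [|a w]; first by rewrite /= subrr.
by rewrite /wd innerB (laB bV) opprD addrACA.
Qed.

Lemma wdN f w : d (fun u => - f u) w = - d f w.
Proof. by case: w => [|a w]; rewrite /wd ?oppr0 // innerN laN opprD. Qed.

Lemma wdD f g w : d (fun u => f u + g u) w = d f w + d g w.
Proof.
by rewrite -[d g w]opprK -wdN -wdB; apply: eq_wd => u _; rewrite opprK.
Qed.

Lemma wd_sum k (f : nat -> seq letter -> V) w :
  d (fun u => \sum_(i < k) f i u) w = \sum_(i < k) d (f i) w.
Proof.
elim: k => [|k IH].
  have := wdB (f 0) (f 0) w; rewrite subrr big_ord0; apply: etrans.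
  by apply: eq_wd => u _; rewrite big_ord0 subrr.
rewrite big_ord_recr /= -IH -wdD; apply: eq_wd => u _.
by rewrite big_ord_recr.
Qed.

Lemma la_inner a f w : la a (I f w) = I (fun u => la a (f u)) w.
Proof.
elim: w f => [|b [|c t] IH] f; first exact: la0.
  by rewrite inner1 laN (laraA bV).
by rewrite !inner_cons (laB bV) laN la_extend IH.
Qed.

(** Associativity of N, tested against an arbitrary map so that zero products are covered as
    well. *)
Lemma lmulA (phi : letter -> V) a b c :
  extend (fun p => extend phi (lmul p c)) (lmul a b) =
  extend (fun q => extend phi (lmul a q)) (lmul b c).
Proof. by case: a => [[] []]; case: b => [[] []]; case: c => [[] []]. Qed.

Lemma inner_extend (F : letter -> seq letter -> V) p w :
  I (fun u => extend (F^~ u) p) w = extend (fun c => I (F c) w) p.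
Proof. by case: p => //=; rewrite inner0. Qed.

Lemma extendB (phi psi : letter -> V) p :
  extend (fun c => phi c - psi c) p = extend phi p - extend psi p.
Proof. by case: p => //=; rewrite subrr. Qed.

(** [inner] is the differential for the zero left action. In the induction, double merges of the
    first three letters cancel by associativity, disjoint merges cancel in pairs, and the rest is
    the induction hypothesis with [a] held fixed. *)
Lemma inner_inner f a b t : I (I f) [:: a, b & t] = 0.
Proof.
elim: t a b f => [|c t IH] a b f.
  rewrite inner_cons !inner1 raN (raA bV).
  by case: (lmul a b) => [p|] /=; rewrite ?opprK ?oppr0 ?addrN ?addr0.
have IHa := IH b c (fun u => f (a :: u)).
rewrite inner_cons in IHa.
rewrite !inner_cons.
have -> : I (fun u => I f [:: a, b & u]) (c :: t) =
  - extend (fun p => I (fun u => f (p :: u)) (c :: t)) (lmul a b)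
  - I (fun u => I (fun v => f (a :: v)) (b :: u)) (c :: t).
  rewrite -inner_extend -innerN -innerB; exact: eq_inner.
have -> : extend (fun p => I f [:: p, c & t]) (lmul a b) =
  - extend (fun p => extend (fun q => f (q :: t)) (lmul p c)) (lmul a b)
  - extend (fun p => I (fun u => f (p :: u)) (c :: t)) (lmul a b).
  by case: (lmul a b) => //=; rewrite oppr0 addr0.
have -> : extend (fun p => I f [:: a, p & t]) (lmul b c) =
  - extend (fun q => extend (fun p => f (p :: t)) (lmul a q)) (lmul b c)
  - extend (fun q => I (fun u => f (a :: u)) (q :: t)) (lmul b c).
  by case: (lmul b c) => //=; rewrite oppr0 addr0.
rewrite lmulA; move: IHa.
set X1 := extend _ _; set X2 := I _ _; set X3 := extend _ _; set X4 := extend _ _.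
move=> /eqP; rewrite subr_eq0 => /eqP <-.
by rewrite !opprD !opprK [X in _ + X]addrACA addNr addr0 -opprD subrr.
Qed.

(** Split [d] into its first term and [inner]: two left actions cancel against a merge by [laA], the
    left action commutes with [inner], and [inner_inner] disposes of the rest. *)
Lemma wd_wd f a b t : d (d f) [:: a, b & t] = 0.
Proof.
rewrite [LHS]/wd; have -> : I (d f) [:: a, b & t] =
  - extend (la^~ (f t)) (lmul a b) - la a (I f (b :: t)) + I (I f) [:: a, b & t].
  rewrite la_inner !inner_cons.
  have -> : extend (fun c => d f (c :: t)) (lmul a b) =
     extend (la^~ (f t)) (lmul a b) + extend (fun c => I f (c :: t)) (lmul a b).
    by case: (lmul a b) => //=; rewrite addr0.
  have -> : I (fun u => d f (a :: u)) (b :: t) =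
     I (fun u => la a (f u)) (b :: t) + I (fun u => I f (a :: u)) (b :: t).
    exact: innerD.
  by rewrite !opprD addrACA.
rewrite inner_inner addr0 addrA -(laA bV) /wd -(laB bV) -(laB bV).
by rewrite [la b _ + _]addrC addrK subrr la0.
Qed.

(** All products of adjacent letters vanish, so only the right action of the last letter
    survives. *)
Lemma inner_koszul f u b : koszul (rcons u b) ->
  I f (rcons u b) = if odd (size u) then ra b (f u) else - ra b (f u).
Proof.
elim: u f => [|a u IH] f kau; first exact: inner1.
have /IH{}IH := koszul_cons kau.
have -> : I f (rcons (a :: u) b) = - I (fun u => f (a :: u)) (rcons u b).
  case: u kau {IH} => [|c u]; last first.
    move=> /andP[_ /andP[/eqP ac _]].
    by rewrite rcons_cons inner_cons ac oppr0 add0r.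
  move=> /andP[_ /andP[/eqP ac _]].
  by rewrite rcons_cons inner_cons ac oppr0 add0r.
by rewrite IH /=; case: (odd _); rewrite /= ?opprK.
Qed.

Lemma inner_koszul0 f u b : koszul (rcons u b) -> f u = 0 -> I f (rcons u b) = 0.
Proof. by move=> kub fu; rewrite inner_koszul // fu ra0 oppr0 if_same. Qed.

Lemma la1_la a v : la l1 (la a v) = la a v.
Proof. by rewrite (laA bV); case: a => [[] []]. Qed.

Lemma la_la1 a v : la a (la l1 v) = la a v.
Proof. by rewrite (laA bV); case: a => [[] []]. Qed.

(** [la l1] is an idempotent endomorphism of the bimodule: it commutes with the right action and
    fixes the image of every [la a]. *)
Lemma wd_la1 f w : d (fun u => la l1 (f u)) w = la l1 (d f w).
Proof.
by case: w => [|a w]; rewrite /wd ?la0 // -la_inner la_la1 laD la1_la.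
Qed.

(* Where the left action is not unital, prepending a unit letter is a
   contracting homotopy. *)
Lemma cocycle_la1 f a w : d f [:: l1, a & w] = 0 ->
  f (a :: w) = la l1 (f (a :: w))
               - d (fun u => f (l1 :: u) - la l1 (f (l1 :: u))) (a :: w).
Proof.
case: a => a1 a2; rewrite /wd inner_cons [extend _ _]/= => /eqP.
rewrite addrA subr_eq0 => /eqP E.
rewrite (laB bV) la_la1 subrr add0r innerB -la_inner -E (laB bV) la1_la subrr.
by rewrite subr0 opprB addrC subrK.
Qed.

(* Correction by which a cocycle is made to vanish on all words whose tail is Koszul. *)
Definition push f (w : seq letter) : V :=
  if w is a :: u then
    if koszul u then
      if a == l1 then f [:: l1, l1 & u]
      else if a == lz then - f [:: lx, ly & u] else 0
    else 0
  else 0.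

Arguments push : simpl never.

Lemma push1 f w : koszul w -> push f (l1 :: w) = f [:: l1, l1 & w].
Proof. by rewrite /push => ->. Qed.

Lemma push_koszul f w : koszul w -> push f w = 0.
Proof. by case: w => [//|[[] []] w] // _; rewrite /push /= if_same. Qed.

Lemma wd_push_koszul f w : koszul w -> d (push f) w = 0.
Proof.
case: w => [//|a w] kaw; rewrite /wd push_koszul ?la0 ?add0r; last exact: koszul_cons kaw.
case/lastP: (a :: w) kaw => [//|u b] kub.
by rewrite inner_koszul0 // push_koszul //; apply: koszul_rcons kub.
Qed.

(** Merging x and y reaches [push f] at z, whose sign is chosen for this; the other terms evaluate
    [push f] at a Koszul word or at x followed by one, where it is zero. *)
Lemma wd_push_xy f w : koszul w -> d (push f) [:: lx, ly & w] = f [:: lx, ly & w].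
Proof.
move=> kw; have kyw : koszul (ly :: w) by rewrite koszul_y.
rewrite /wd (push_koszul f kyw) la0 add0r inner_cons /= /push /= kw opprK -/(push f).
rewrite [X in _ - X](_ : _ = 0) ?subr0 //.
case/lastP: (ly :: w) kyw => [//|u b] kub.
by rewrite inner_koszul0 //= if_same.
Qed.

(** The first merge cancels against the merge of the second unit with [w] (against the right action
    of the unit if [w] is empty), which leaves the left action term. *)
Lemma wd_push_11 f w : koszul w ->
  d (push f) [:: l1, l1 & w] = la l1 (f [:: l1, l1 & w]).
Proof.
case: w => [|[c1 c2] w] kw.
  by rewrite /wd inner_cons inner1 /= push1 // (ra1 bV) opprK addNr addr0.
rewrite /wd !inner_cons /= !push1 // opprD !opprK addKr.
rewrite [X in _ + X](_ : _ = 0) ?addr0 //.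
case/lastP: (_ :: w) kw => [//|u b] kub.
by rewrite inner_koszul0.
Qed.

End WordCochains.

Arguments inner : simpl never.
Arguments push : simpl never.

(** * Currying the first argument, and acyclicity off the Koszul words *)

Section Currying.
Variables (V : zmodType) (la ra : letter -> V -> V).
Hypothesis bV : bimodule la ra.

(** The twisted left action on Hom(N, V): the subtracted term absorbs the first term of the
    differential of V, so that [wd_uncurry] matches the two complexes up to sign and a shift of
    degree. *)
Definition curry_la (b : letter) (phi : {ffun letter -> V}) : {ffun letter -> V} :=
  [ffun a => extend phi (lmul a b) - la a (phi b)].

Definition curry_ra (b : letter) (phi : {ffun letter -> V}) : {ffun letter -> V} :=
  [ffun a => ra b (phi a)].

Lemma extend_ffunE (W : finType) (F : letter -> {ffun W -> V}) p x :
  extend F p x = extend (fun c => F c x) p.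
Proof. by case: p => //=; rewrite ffunE. Qed.

Lemma curry_bimodule : bimodule curry_la curry_ra.
Proof.
split.
- move=> a u v; apply/ffunP=> x; rewrite !ffunE (laB bV).
  have -> : extend (u - v) (lmul x a) = extend u (lmul x a) - extend v (lmul x a).
    by case: (lmul x a) => [c|] /=; rewrite ?ffunE ?subr0.
  by rewrite !opprD !opprK addrACA.
- by move=> a u v; apply/ffunP=> x; rewrite !ffunE (raB bV).
- move=> b c phi; apply/ffunP=> a; rewrite extend_ffunE !ffunE.
  rewrite (laB bV) (laA bV) (la_extend bV).
  have -> : extend (curry_la c phi) (lmul a b) =
      extend (fun p => extend phi (lmul p c)) (lmul a b)
      - extend (la^~ (phi c)) (lmul a b).
    by rewrite -extendB; apply: eq_extend => p; rewrite ffunE.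
  have -> : extend (fun q => curry_la q phi a) (lmul b c) =
      extend (fun q => extend phi (lmul a q)) (lmul b c)
      - extend (fun q => la a (phi q)) (lmul b c).
    by rewrite -extendB; apply: eq_extend => q; rewrite ffunE.
  by rewrite lmulA opprB addrA subrK.
- move=> a b phi; apply/ffunP=> x; rewrite extend_ffunE !ffunE (raA bV).
  by case: (lmul a b) => //= c; rewrite ffunE.
- move=> a b phi; apply/ffunP=> x; rewrite !ffunE (raB bV) (laraA bV).
  by case: (lmul x a) => [c|] //=; rewrite ?ffunE ?(ra0 bV).
- by move=> phi; apply/ffunP=> x; rewrite !ffunE (ra1 bV).
Qed.

Definition uncurry (h : seq letter -> {ffun letter -> V}) (w : seq letter) : V :=
  if w is a :: u then h u a else 0.

Lemma inner_curry h a w : inner curry_ra h w a = inner ra (fun u => h u a) w.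
Proof.
elim: w h => [|b [|c t] IH] h; first by rewrite ffunE.
  by rewrite !inner1 !ffunE.
by rewrite !inner_cons !ffunE IH extend_ffunE.
Qed.

Lemma wd_uncurry h a b t :
  wd la ra (uncurry h) [:: a, b & t] = - wd curry_la curry_ra h (b :: t) a.
Proof.
rewrite /wd inner_cons !ffunE inner_curry /=.
have -> : extend (fun c => h t c) (lmul a b) = extend (h t) (lmul a b) by [].
by rewrite !opprD opprK addrA [- _ + _]addrC.
Qed.

End Currying.

(** The bimodule varies in the induction because currying changes it. The curried cochain is tested
    on tails, which is why vanishing on all words with Koszul tail has to be arranged first. *)
Lemma acyclic n (V : zmodType) (la ra : letter -> V -> V) (f : seq letter -> V) :
  bimodule la ra ->
  (forall w, size w = n.+1 -> wd la ra f w = 0) ->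
  (forall w, size w = n -> koszul w -> f w = 0) ->
  exists h, forall w, size w = n -> f w = wd la ra h w.
Proof.
elim: n V la ra f => [|n IH] V la ra f bV df fk.
  by exists (fun=> 0) => -[|//] _; rewrite fk.
pose d := wd la ra.
(* [f1] is cohomologous to [f]. It is projected to [f2] because [wd_push_11] controls the value at
   1, 1, w only after applying [la l1]; [cocycle_la1] shows that the projection changes [f1] by a
   coboundary. *)
pose f1 w := f w - d (push f) w.
pose f2 w := la l1 (f1 w).
have df1 w : size w = n.+2 -> d f1 w = 0.
  move=> sw; rewrite /d (wdB bV) df // sub0r.
  by case: w sw => [|a [|b w]] // _; rewrite /d (wd_wd bV) ?oppr0.
have df2 w : size w = n.+2 -> d f2 w = 0.
  by move=> sw; rewrite /d (wd_la1 bV) // [wd _ _ _ _]df1 // (la0 bV).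
have f2k w : size w = n.+1 -> koszul w -> f2 w = 0.
  by move=> sw kw; rewrite /f2 /f1 fk // /d (wd_push_koszul bV) // subr0 (la0 bV).
have f2xy w : (size w).+1 = n -> koszul w -> f2 [:: lx, ly & w] = 0.
  by move=> sw kw; rewrite /f2 /f1 /d (wd_push_xy bV) // subrr (la0 bV).
have f211 w : (size w).+1 = n -> koszul w -> f2 [:: l1, l1 & w] = 0.
  by move=> sw kw; rewrite /f2 /f1 /d (wd_push_11 bV) // (laB bV) (la1_la bV) // subrr.
have la1f2 w : la l1 (f2 w) = f2 w by rewrite (la1_la bV).
(* Either [w] starts with y and [f2xy] applies, or [lx :: w] is itself Koszul. *)
have f2x w : size w = n -> koszul w -> f2 (lx :: w) = 0.
  case: w => [|[[] []] w] // sw kw; first by apply: f2k => //; rewrite -sw.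
  - by apply: f2k => //; rewrite -sw.
  - by apply: f2xy => //; rewrite -(koszul_y w).
(* In the cocycle identity at x, y, w the merge xy yields the value at z, w; the other terms vanish
   by [f2k] and [f2x]. *)
have f2z w : size w = n -> koszul w -> f2 (lz :: w) = 0.
  move=> sw kw; have kyw : koszul (ly :: w) by rewrite koszul_y.
  have : d f2 [:: lx, ly & w] = 0 by rewrite df2 //= sw.
  rewrite /d /wd inner_cons f2k //= ?sw // (la0 bV) add0r => /eqP.
  rewrite subr_eq0 => /eqP E; apply/eqP; rewrite -oppr_eq0 E {E}.
  have: size (ly :: w) = n.+1 by rewrite /= sw.
  case/lastP: (ly :: w) kyw => [//|u b] kub; rewrite size_rcons => -[su].
  by rewrite (inner_koszul0 bV) // f2x //; apply: koszul_rcons kub.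
(* In the cocycle identity at 1, 1, w the left action of 1 cancels the first merge; up to sign there
   remain the value at 1, w and, for nonempty [w], a term that [f211] kills. *)
have f21 w : size w = n -> koszul w -> f2 (l1 :: w) = 0.
  move=> sw kw; have : d f2 [:: l1, l1 & w] = 0 by rewrite df2 //= sw.
  rewrite /d /wd inner_cons /= la1f2 addrA subrr sub0r => /eqP; rewrite oppr_eq0 => /eqP.
  case: w sw kw => [|[c1 c2] w] sw kw.
    by rewrite inner1 (ra1 bV) => /eqP; rewrite oppr_eq0 => /eqP.
  rewrite inner_cons /= => /eqP; rewrite subr_eq0 => /eqP E.
  apply/eqP; rewrite -oppr_eq0 E {E}.
  case/lastP: (_ :: w) sw kw => [//|u b]; rewrite size_rcons => su kub.
  by rewrite (inner_koszul0 bV) // f211 //; apply: koszul_rcons kub.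
have f2ak a w : size w = n -> koszul w -> f2 (a :: w) = 0.
  case: a => [[] []] sw kw; [exact: f2z|exact: f2x| |exact: f21].
  by apply: f2k; rewrite ?koszul_y //= sw.
pose cf (w : seq letter) : {ffun letter -> V} := [ffun a => f2 (a :: w)].
have ucf w : (0 < size w)%N -> uncurry cf w = f2 w.
  by case: w => //= a w _; rewrite ffunE.
have [||h fh] := IH _ _ _ cf (curry_bimodule bV).
- move=> [//|b t] [st]; apply/ffunP=> a; rewrite [RHS]ffunE; apply/eqP.
  rewrite -oppr_eq0 -wd_uncurry; apply/eqP.
  rewrite -[RHS](df2 [:: a, b & t]); last by rewrite /= st.
  by apply: eq_wd => u /= su; rewrite ucf ?su.
- by move=> w sw kw; apply/ffunP=> a; rewrite !ffunE f2ak.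
pose k u := f1 (l1 :: u) - la l1 (f1 (l1 :: u)).
(* On words of this length [f] is [f1 + d (push f)], [f1] is [f2 - d k], and [f2] is
   [- d (uncurry h)]. *)
exists (fun w => push f w - uncurry h w - k w).
move=> [//|a w] [sw]; rewrite (wdB bV) (wdB bV).
have := cocycle_la1 bV (df1 [:: l1, a & w] (congr1 S (congr1 S sw))).
rewrite -[la l1 (f1 (a :: w))]/(f2 (a :: w)) -/k.
have -> : f2 (a :: w) = - wd la ra (uncurry h) (a :: w).
  have -> : f2 (a :: w) = cf w a by rewrite ffunE.
  rewrite fh //; case: w {sw} => [|b t]; last by rewrite wd_uncurry opprK.
  (* For a word of length one both sides are zero, since [uncurry h] is 0 on the empty word. *)
  by rewrite [in LHS]/= ffunE /wd inner1 /= (la0 bV) (ra0 bV) subrr oppr0.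
by move=> E; rewrite -addrA -E /f1 addrC subrK.
Qed.

(** * The bimodule M/N *)

Notation o0 := (ord0 : 'I_3).
Notation o1 := (lift ord0 ord0 : 'I_3).
Notation o2 := (lift ord0 (lift ord0 ord0) : 'I_3).

Lemma ord3_ind (P : 'I_3 -> Prop) : P o0 -> P o1 -> P o2 -> forall i, P i.
Proof.
move=> P0 P1 P2 [[|[|[|//]]] lt_i].
- by rewrite (_ : Ordinal _ = o0) //; apply: val_inj.
- by rewrite (_ : Ordinal _ = o1) //; apply: val_inj.
- by rewrite (_ : Ordinal _ = o2) //; apply: val_inj.
Qed.

Lemma mulmx3E (R : pzRingType) (A B : 'M[R]_3) i j :
  (A *m B) i j = A i o0 * B o0 j + A i o1 * B o1 j + A i o2 * B o2 j.
Proof. by rewrite mxE !big_ord_recl big_ord0 addr0 addrA. Qed.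

Section Quotient.
Variable R : comPzRingType.
Implicit Types (m x y : 'M[R]_3) (a b : letter).

Lemma nmatE (a b c d : R) :
  (nmat a b c d o0 o0 = a) * (nmat a b c d o0 o1 = b) * (nmat a b c d o0 o2 = c) *
  (nmat a b c d o1 o0 = 0) * (nmat a b c d o1 o1 = a) * (nmat a b c d o1 o2 = d) *
  (nmat a b c d o2 o0 = 0) * (nmat a b c d o2 o1 = 0) * (nmat a b c d o2 o2 = a).
Proof. by rewrite !mxE. Qed.

Lemma inNP m : inN m <->
  [/\ m o1 o0 = 0, m o2 o0 = 0, m o2 o1 = 0, m o0 o0 = m o2 o2 & m o1 o1 = m o2 o2].
Proof.
split=> [[a [b [c [d ->]]]]|[m10 m20 m21 m00 m11]]; first by split; rewrite !nmatE.
exists (m o0 o0), (m o0 o1), (m o0 o2), (m o1 o2); apply/matrixP.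
by elim/ord3_ind; elim/ord3_ind; rewrite !nmatE // m00.
Qed.

Lemma inN_lin (r : R) x y : inN x -> inN y -> inN (r *: x + y).
Proof.
move=> /inNP[x10 x20 x21 x00 x11] /inNP[y10 y20 y21 y00 y11]; apply/inNP.
by rewrite !mxE x10 x20 x21 x00 x11 y10 y20 y21 y00 y11 !mulr0 !addr0.
Qed.

Lemma inN0 : inN (0 : 'M[R]_3).
Proof. by apply/inNP; rewrite !mxE. Qed.

Lemma inN_mul x y : inN x -> inN y -> inN (x *m y).
Proof.
move=> /inNP[x10 x20 x21 x00 x11] /inNP[y10 y20 y21 y00 y11]; apply/inNP.
rewrite !mulmx3E x10 x20 x21 x00 x11 y10 y20 y21 y00 y11.
by split; ring.
Qed.

Definition vec5 (p q s d1 d2 : R) : 'rV[R]_5 := \row_(k < 5) nth 0 [:: p; q; s; d1; d2] k.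

Definition coord (v : 'rV[R]_5) (k : nat) : R := v ord0 (inord k).

Lemma coord_vec5 p q s d1 d2 k : (k < 5)%N ->
  coord (vec5 p q s d1 d2) k = nth 0 [:: p; q; s; d1; d2] k.
Proof. by move=> lt_k; rewrite /coord mxE inordK. Qed.

Lemma vec5_eta v : v = vec5 (coord v 0) (coord v 1) (coord v 2) (coord v 3) (coord v 4).
Proof.
apply/rowP => -[[|[|[|[|[|//]]]]] lt_k]; rewrite mxE /=; congr (v _ _);
  by apply: val_inj; rewrite /= inordK.
Qed.

(* The class of [m] in M/N, in the basis E21, E31, E32, E11, E22. *)
Definition pr m : 'rV[R]_5 :=
  vec5 (m o1 o0) (m o2 o0) (m o2 o1) (m o0 o0 - m o2 o2) (m o1 o1 - m o2 o2).

Definition sec (v : 'rV[R]_5) : 'M[R]_3 :=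
  \matrix_(i < 3, j < 3)
    match nat_of_ord i, nat_of_ord j with
    | 1, 0 => coord v 0
    | 2, 0 => coord v 1
    | 2, 1 => coord v 2
    | 0, 0 => coord v 3
    | 1, 1 => coord v 4
    | _, _ => 0
    end.

Lemma secE v :
  (sec v o0 o0 = coord v 3) * (sec v o0 o1 = 0) * (sec v o0 o2 = 0) *
  (sec v o1 o0 = coord v 0) * (sec v o1 o1 = coord v 4) * (sec v o1 o2 = 0) *
  (sec v o2 o0 = coord v 1) * (sec v o2 o1 = coord v 2) * (sec v o2 o2 = 0).
Proof. by rewrite !mxE. Qed.

Lemma pr_is_linear : linear pr.
Proof.
move=> r x y; apply/rowP => -[[|[|[|[|[|//]]]]] lt_k]; rewrite !mxE /= ?mxE //; ring.
Qed.

HB.instance Definition _ := GRing.isLinear.Build R _ _ _ pr pr_is_linear.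

Lemma inN_pr m : inN m <-> pr m = 0.
Proof.
split=> [/inNP[m10 m20 m21 m00 m11]|prm].
  apply/rowP => -[[|[|[|[|[|//]]]]] lt_k]; rewrite !mxE //= ?m00 ?m11 ?subrr //.
have prk k : (k < 5)%N -> coord (pr m) k = 0 by rewrite prm /coord mxE.
move: (prk 0 isT) (prk 1 isT) (prk 2 isT) (prk 3 isT) (prk 4 isT).
rewrite !coord_vec5 //= => m10 m20 m21 /eqP; rewrite subr_eq0 => /eqP m00 /eqP.
by rewrite subr_eq0 => /eqP m11; apply/inNP.
Qed.

Lemma inN_sub x y : inN (x - y) <-> pr x = pr y.
Proof.
rewrite inN_pr raddfB /=; split=> [/eqP|->]; last by rewrite subrr.
by rewrite subr_eq0 => /eqP.
Qed.

Lemma prK : cancel sec pr.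
Proof. by move=> v; rewrite /pr !secE !subr0 -vec5_eta. Qed.

(** N is closed under products, so multiplication by an element of N descends to M/N. *)
Lemma pr_mull x m m' : inN x -> pr m = pr m' -> pr (x *m m) = pr (x *m m').
Proof.
by move=> Nx /inN_sub Nm; apply/inN_sub; rewrite -mulmxBr; apply: inN_mul.
Qed.

Lemma pr_mulr x m m' : inN x -> pr m = pr m' -> pr (m *m x) = pr (m' *m x).
Proof.
by move=> Nx /inN_sub Nm; apply/inN_sub; rewrite -mulmxBl; apply: inN_mul.
Qed.

Definition Emat a : 'M[R]_3 :=
  nmat (a == l1)%:R (a == lx)%:R (a == lz)%:R (a == ly)%:R.

Definition coef a m : R :=
  if a.1 then if a.2 then m o0 o2 else m o0 o1 else if a.2 then m o1 o2 else m o0 o0.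

Lemma inN_Emat a : inN (Emat a).
Proof. by do 4!eexists. Qed.

Lemma coef_Emat a b : coef a (Emat b) = (a == b)%:R.
Proof. by case: a => [[] []]; case: b => [[] []]; rewrite /coef /= !nmatE. Qed.

Lemma coef_linear a (r : R) x y : coef a (r *: x + y) = r * coef a x + coef a y.
Proof. by case: a => [[] []]; rewrite /coef /= !mxE. Qed.

(** The sum is nested and ends in 0 so that multilinearity, stated for [r *: x + y], expands it term
    by term. *)
Lemma Emat_decomp m : inN m ->
  m = coef l1 m *: Emat l1 + (coef lx m *: Emat lx +
      (coef ly m *: Emat ly + (coef lz m *: Emat lz + 0))).
Proof.
move=> [a [b [c [d ->]]]]; rewrite /coef /= !nmatE.
by apply/matrixP; elim/ord3_ind; elim/ord3_ind; rewrite !mxE /=; ring.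
Qed.

Lemma Emat_mul a b : Emat a *m Emat b = extend Emat (lmul a b).
Proof.
apply/matrixP.
case: a => [[] []]; case: b => [[] []]; elim/ord3_ind; elim/ord3_ind;
rewrite mulmx3E /= !mxE /=; ring.
Qed.

Definition qla a (v : 'rV[R]_5) := pr (Emat a *m sec v).
Definition qra a (v : 'rV[R]_5) := pr (sec v *m Emat a).

Lemma qla_pr a m : qla a (pr m) = pr (Emat a *m m).
Proof. by apply: pr_mull (inN_Emat a) (prK _). Qed.

Lemma qra_pr a m : qra a (pr m) = pr (m *m Emat a).
Proof. by apply: pr_mulr (inN_Emat a) (prK _). Qed.

Lemma Emat1 : Emat l1 = 1%:M.
Proof. by apply/matrixP; elim/ord3_ind; elim/ord3_ind; rewrite !mxE. Qed.

Lemma quotient_bimodule : bimodule qla qra.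
Proof.
split.
- by move=> a u v; rewrite -(prK u) -(prK v) -raddfB !qla_pr mulmxBr raddfB.
- by move=> a u v; rewrite -(prK u) -(prK v) -raddfB !qra_pr mulmxBl raddfB.
- move=> a b v; rewrite -(prK v) !qla_pr mulmxA Emat_mul.
  by case: (lmul a b) => [c|] /=; rewrite ?qla_pr // mul0mx raddf0.
- move=> a b v; rewrite -(prK v) !qra_pr -mulmxA Emat_mul.
  by case: (lmul a b) => [c|] /=; rewrite ?qra_pr // mulmx0 raddf0.
- by move=> a b v; rewrite -(prK v) qra_pr !qla_pr qra_pr mulmxA.
- by move=> v; rewrite -(prK v) qra_pr Emat1 mulmx1.
Qed.

Lemma qlaE a v : qla a v =
  if a == l1 then v else if a == lx then vec5 0 0 0 (coord v 0) 0 else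
  if a == ly then vec5 (coord v 1) 0 0 0 (coord v 2) else vec5 0 0 0 (coord v 1) 0.
Proof.
case: a => [[] []] /=; rewrite /qla ?Emat1 ?mul1mx ?prK // /pr !mulmx3E !secE !nmatE /=;
  congr vec5; ring.
Qed.

(** The signs arise because E33 is -E11 - E22 modulo N. *)
Lemma qraE a v : qra a v =
  if a == l1 then v else if a == lx then vec5 0 0 (coord v 1) 0 (coord v 0) else
  if a == ly then vec5 0 0 0 (- coord v 2) (- coord v 2)
  else vec5 0 0 0 (- coord v 1) (- coord v 1).
Proof.
case: a => [[] []] /=; rewrite /qra ?Emat1 ?mulmx1 ?prK // /pr !mulmx3E !secE !nmatE /=;
  congr vec5; ring.
Qed.

End Quotient.

(** * From multilinear cochains to word cochains *)

Section Cochains.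
Variable R : comPzRingType.

Definition basis_args n (w : seq letter) (i : 'I_n) : 'M[R]_3 := Emat R (nth l1 w i).

Definition words n (f : cochain R n) (w : seq letter) : 'rV[R]_5 :=
  pr (f (basis_args w)).

Lemma allN_basis_args n w : allN (@basis_args n w).
Proof. by move=> i; apply: inN_Emat. Qed.

Lemma allN_upd n (v : 'I_n -> 'M[R]_3) i x : allN v -> inN x -> allN (upd v i x).
Proof. by move=> Nv Nx j; rewrite /upd; case: eqP. Qed.

Lemma upd_id n (v : 'I_n -> 'M[R]_3) i : upd v i (v i) = v.
Proof. by apply: functional_extensionality => j; rewrite /upd; case: eqP => [->|]. Qed.

Lemma multilinearP n (f : cochain R n) :
  multilinear f <->
  (forall v i x y r, allN v -> inN x -> inN y ->
     pr (f (upd v i (r *: x + y))) = r *: pr (f (upd v i x)) + pr (f (upd v i y))).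
Proof.
split=> fl v i x y r Nv Nx Ny; have := fl v i x y r Nv Nx Ny.
  by move/inN_sub => ->; rewrite linearP.
by move=> E; apply/inN_sub; rewrite E linearP.
Qed.

Lemma multilinear0 n (f : cochain R n) v i : multilinear f -> allN v ->
  pr (f (upd v i 0)) = 0.
Proof.
move=> /multilinearP fl Nv; have := fl v i 0 0 (-1) Nv (inN0 _) (inN0 _).
by rewrite scaler0 addr0 scaleN1r addNr.
Qed.

(** The matrices [Emat] span N, so the arguments can be expanded one at a time. *)
Lemma multilinear_eq0 n (f : cochain R n) : multilinear f ->
  (forall w, size w = n -> words f w = 0) -> forall v, allN v -> inN (f v).
Proof.
move=> fl f0.
(* [k] bounds the number of leading arguments that are still arbitrary elements of N. *)
have step k : (k <= n)%N -> forall v, allN v ->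
    (forall i : 'I_n, (k <= i)%N -> exists a, v i = Emat R a) -> pr (f v) = 0.
  elim: k => [_ v Nv vE|k IH lt_kn v Nv vE].
    have [s sE] : exists s : 'I_n -> letter, forall i, v i = Emat R (s i).
      exists (fun i => if [pick a | v i == Emat R a] is Some a then a else l1) => i.
      case: pickP => [a /eqP //|no]; have [a va] := vE i isT.
      by have := no a; rewrite va eqxx.
    have sw : size (map s (enum 'I_n)) = n by rewrite size_map size_enum_ord.
    rewrite -(f0 _ sw) /words.
    congr (pr (f _)); apply: functional_extensionality => i.
    by rewrite /basis_args (nth_map i) ?size_enum_ord // nth_ord_enum sE.
  pose i := Ordinal lt_kn.
  have upd0 a : pr (f (upd v i (Emat R a))) = 0.
    apply: (IH (ltnW lt_kn)); first exact: allN_upd (inN_Emat _ _).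
    move=> j le_kj; rewrite /upd; case: eqP => [_|/eqP ji]; first by exists a.
    by apply: vE; rewrite ltn_neqAle le_kj andbT eq_sym.
  rewrite -[v](upd_id v i) (Emat_decomp (Nv i)).
  move/multilinearP: (fl) => fl'.
  have N0 := @inN0 R; have NE := @inN_Emat R.
  rewrite !fl' //; do ?[apply: inN_lin | exact: NE | exact: N0].
  by rewrite !upd0 multilinear0 // !scaler0 !addr0.
by move=> v Nv; apply/inN_pr; apply: (step n) => // i; rewrite leqNgt ltn_ord.
Qed.

Lemma multilinearB n (f g : cochain R n) : multilinear f -> multilinear g ->
  multilinear (fun v => f v - g v).
Proof.
move=> /multilinearP fl /multilinearP gl; apply/multilinearP => v i x y r Nv Nx Ny.
by rewrite !raddfB /= fl // gl // opprD addrACA.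
Qed.

Lemma multilinear_sum n k (r : 'I_k -> R) (c : 'I_k -> cochain R n) :
  (forall i, multilinear (c i)) -> multilinear (fun v => \sum_(i < k) r i *: c i v).
Proof.
move=> cl; apply/multilinearP => v i x y s Nv Nx Ny.
rewrite !raddf_sum -big_split; apply: eq_bigr => j _ /=.
have /multilinearP cj := cl j.
by rewrite !linearZ /= cj // scalerDr !scalerA mulrC.
Qed.

(** The map [phi] is the identity if argument [i] is not merged, and multiplication by its partner,
    on the left or on the right, if it is. Hence merging preserves linearity in each argument. *)
Lemma merge_upd n (v : 'I_n.+1 -> 'M[R]_3) k i : allN v -> (k < n)%N ->
  exists j phi, [/\ forall x, merge (upd v i x) k = upd (merge v k) j (phi x),
    forall x, inN x -> inN (phi x) & linear phi].
Proof.
move=> Nv lt_kn; case: (ltngtP i k) => [lt_ik|lt_ki|eq_ik].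
- have lt_in : (i < n)%N := ltn_trans lt_ik lt_kn.
  exists (Ordinal lt_in), id; split=> // x; apply: functional_extensionality => j.
  rewrite /merge /upd -!val_eqE /= /bump /= !add1n.
  case: (ltngtP j k) => jk //.
  + have -> : (j.+1 == i :> nat) = false by lia.
    by have -> : (j == i :> nat) = false by lia.
  + have -> : (j.+1 == i :> nat) = false by lia.
    by have -> : (j == i :> nat) = false by lia.
- case: (ltngtP i k.+1) => [|lt_ki1|eq_ik]; first by lia.
    have lt_in : (i.-1 < n)%N by have := ltn_ord i; lia.
    exists (Ordinal lt_in), id; split=> // x; apply: functional_extensionality => j.
    rewrite /merge /upd -!val_eqE /= /bump /= !add1n.
    have -> : (j.+1 == i :> nat) = (j == i.-1 :> nat) by lia.
    case: (ltngtP j k) => jk.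
    + have -> : (j == i :> nat) = false by lia.
      by have -> : (j == i.-1 :> nat) = false by lia.
    + by case: eqP.
    + have -> : (j == i :> nat) = false by lia.
      by have -> : (j == i.-1 :> nat) = false by lia.
  exists (Ordinal lt_kn), (mulmx (v (widen_ord (leqnSn n) (Ordinal lt_kn)))).
  split=> [x|x Nx|]; [|exact: inN_mul|exact: linearP].
  apply: functional_extensionality => j.
  rewrite /merge /upd -!val_eqE /= /bump /= !add1n eq_ik eqSS.
  case: (ltngtP j k) => jk //.
  + by have -> : (j == k.+1 :> nat) = false by lia.
  + have -> : (j == k.+1 :> nat) = false by lia.
    by congr (v _ *m _); apply: val_inj.
- exists (Ordinal lt_kn), (mulmxr (v (lift ord0 (Ordinal lt_kn)))).
  split=> [x|x Nx|]; [|exact: inN_mul|exact: linearP].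
  apply: functional_extensionality => j.
  rewrite /merge /upd -!val_eqE /= /bump /= !add1n eq_ik.
  case: (ltngtP j k) => jk //.
  + by have -> : (j.+1 == k :> nat) = false by lia.
  + have -> : (j.+1 == k :> nat) = false by lia.
    by congr (_ *m v _); apply: val_inj; rewrite /= jk.
Qed.

Lemma allN_merge n (v : 'I_n.+1 -> 'M[R]_3) k : allN v -> allN (merge v k).
Proof.
by move=> Nv j; rewrite /merge; case: ifP => // _; case: ifP => // _; apply: inN_mul.
Qed.

Lemma pr_hoch_d n (f : cochain R n) v :
  pr (hoch_d f v) = pr (v ord0 *m f (fun j => v (lift ord0 j)))
    + \sum_(k < n) (-1) ^+ k.+1 *: pr (f (merge v k))
    + (-1) ^+ n.+1 *: pr (f (fun j => v (widen_ord (leqnSn n) j)) *m v ord_max).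
Proof.
rewrite /hoch_d !raddfD /= raddf_sum linearZ /=; congr (_ + _ + _).
by apply: eq_bigr => k _; rewrite linearZ.
Qed.

Lemma multilinear_hoch_d n (f : cochain R n) : multilinear f -> multilinear (hoch_d f).
Proof.
move=> fl; move/multilinearP: (fl) => fl'; apply/multilinearP => v i x y r Nv Nx Ny.
pose P (phi : 'M[R]_3 -> 'rV[R]_5) := phi (r *: x + y) = r *: phi x + phi y.
have PD phi psi : P phi -> P psi -> P (fun z => phi z + psi z).
  by rewrite /P => -> ->; rewrite scalerDr addrACA.
have PZ c phi : P phi -> P (fun z => c *: phi z).
  by rewrite /P => ->; rewrite scalerDr !scalerA mulrC.
have PS (phi : 'I_n -> _) : (forall k, P (phi k)) -> P (fun z => \sum_(k < n) phi k z).
  rewrite /P => Pphi; rewrite scaler_sumr -big_split.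
  by apply: eq_bigr => k _; apply: Pphi.
pose T0 z := pr (upd v i z ord0 *m f (fun j => upd v i z (lift ord0 j))).
pose T1 (k : 'I_n) z := pr (f (merge (upd v i z) k)).
pose T2 z := pr (f (fun j => upd v i z (widen_ord (leqnSn n) j)) *m upd v i z ord_max).
suff: P (fun z => T0 z + \sum_(k < n) (-1) ^+ k.+1 *: T1 k z + (-1) ^+ n.+1 *: T2 z).
  by rewrite /P /T0 /T1 /T2 -!pr_hoch_d.
have [Nt Ni] : allN (fun j => v (lift ord0 j)) /\
    allN (fun j => v (widen_ord (leqnSn n) j)) by split=> j; apply: Nv.
apply: (PD (fun z => T0 z + _)); [apply: (PD T0)|apply: PZ].
- rewrite /P /T0; case: (unliftP ord0 i) => [j ->|->].
    have tailE z : (fun k => upd v (lift ord0 j) z (lift ord0 k)) =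
        upd (fun k => v (lift ord0 k)) j z.
      by apply: functional_extensionality => k; rewrite /upd (inj_eq lift_inj).
    have headE z : upd v (lift ord0 j) z ord0 = v ord0 by [].
    rewrite !tailE !headE -linearP scalemxAr -mulmxDr; apply: pr_mull => //.
    by rewrite fl' // linearP.
  have tailE z : (fun k => upd v ord0 z (lift ord0 k)) = (fun k => v (lift ord0 k)).
    by apply: functional_extensionality.
  by rewrite !tailE /upd eqxx mulmxDl -scalemxAl linearP.
- apply: PS => k; apply: PZ; have [j [phi [mE Nphi lphi]]] := merge_upd i Nv (ltn_ord k).
  by rewrite /P /T1 !mE lphi fl' //; [apply: allN_merge|apply: Nphi|apply: Nphi].
- have widenE k : widen_ord (leqnSn n) k = lift ord_max k.
    by apply: ord_inj; rewrite lift_max.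
  rewrite /P /T2; case: (unliftP ord_max i) => [j ->|->].
    have initE z : (fun k => upd v (lift ord_max j) z (widen_ord (leqnSn n) k)) =
        upd (fun k => v (widen_ord (leqnSn n) k)) j z.
      by apply: functional_extensionality => k; rewrite /upd widenE (inj_eq lift_inj).
    have lastE z : upd v (lift ord_max j) z ord_max = v ord_max.
      by rewrite /upd (negPf (neq_lift _ _)).
    rewrite !initE !lastE -linearP scalemxAl -mulmxDl; apply: pr_mulr => //.
    by rewrite fl' // linearP.
  have initE z : (fun k => upd v ord_max z (widen_ord (leqnSn n) k)) =
      (fun k => v (widen_ord (leqnSn n) k)).
    apply: functional_extensionality => k.
    by rewrite /upd widenE eq_sym (negPf (neq_lift _ _)).
  by rewrite !initE /upd eqxx mulmxDr -scalemxAr linearP.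
Qed.

(** Unrolls the recursive sign flips into the explicit signs of [hoch_d]. *)
Lemma inner_sum n (F : seq letter -> 'rV[R]_5) w : size w = n.+1 ->
  inner (@qra R) F w =
  \sum_(k < n) (-1) ^+ k.+1 *:
    extend (fun c => F (take k w ++ c :: drop k.+2 w)) (lmul (nth l1 w k) (nth l1 w k.+1))
  + (-1) ^+ n.+1 *: qra (nth l1 w n) (F (take n w)).
Proof.
elim: n w F => [|n IH] [|a [|b t]] F // sw.
  by rewrite inner1 big_ord0 add0r expr1 scaleN1r.
rewrite inner_cons (IH (b :: t)); last exact: succn_inj sw.
rewrite big_ord_recl /= drop0 expr1 scaleN1r -addrA.
congr (_ + _); rewrite opprD -sumrN; congr (_ + _).
  by apply: eq_bigr => k _; rewrite /bump /= !add1n !add0n; rewrite [in RHS]exprS mulN1r scaleNr.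
by rewrite [in RHS]exprS mulN1r scaleNr.
Qed.

Lemma words_hoch_d n (f : cochain R n) w : multilinear f -> size w = n.+1 ->
  words (hoch_d f) w = wd (@qla R) (@qra R) (words f) w.
Proof.
move=> fl sw; rewrite /words pr_hoch_d -addrA.
case: w sw => [//|a w] sw; rewrite /wd (inner_sum _ sw); congr (_ + (_ + _)).
- by rewrite -qla_pr.
- apply: eq_bigr => k _; congr (_ *: _); move: (a :: w) sw => {a}w sw.
  have lt_kn := ltn_ord k.
  case mE: (lmul (nth l1 w k) (nth l1 w k.+1)) => [c|] /=.
    congr (pr (f _)); apply: functional_extensionality => j.
    rewrite /merge /basis_args /= /bump /= add1n nth_cat size_take sw.
    have -> : (k < n.+1)%N by lia.
    case: (ltngtP j k) => jk.
    + by rewrite nth_take.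
    + have -> : (j - k)%N = (j - k.+1).+1 by lia.
      by rewrite /= nth_drop; congr (Emat R (nth _ _ _)); lia.
    + by rewrite jk subnn Emat_mul mE.
  (* If the two letters multiply to zero, the merged tuple has a zero argument and multilinearity
     kills the term. *)
  set v := merge _ _; have -> : v = upd v k 0.
    apply: functional_extensionality => j; rewrite /upd; case: eqP => // ->.
    by rewrite /v /merge ltnn eqxx /basis_args /= /bump /= add1n Emat_mul mE.
  by apply: multilinear0 => //; apply/allN_merge/allN_basis_args.
- congr (_ *: _); rewrite -qra_pr; congr (qra _ (pr (f _))).
  apply: functional_extensionality => j.
  by rewrite /basis_args nth_take.
Qed.

(** The multilinear extension of a function on words, its values lifted to M. *)
Definition unwords n (G : seq letter -> 'rV[R]_5) : cochain R n :=
  fun v => \sum_(w : n.-tuple letter) (\prod_(i < n) coef (tnth w i) (v i)) *: sec (G w).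

Lemma pr_unwords n G v : pr (@unwords n G v) =
  \sum_(w : n.-tuple letter) (\prod_(i < n) coef (tnth w i) (v i)) *: G w.
Proof. by rewrite raddf_sum; apply: eq_bigr => w _ /=; rewrite linearZ /= prK. Qed.

Lemma prod_upd n (v : 'I_n -> 'M[R]_3) (phi : 'I_n -> 'M[R]_3 -> R) i x :
  \prod_(j < n) phi j (upd v i x j) = phi i x * \prod_(j < n | j != i) phi j (v j).
Proof.
rewrite (bigD1 i) //= {1}/upd eqxx; congr (_ * _).
by apply: eq_bigr => j /negPf ji; rewrite /upd ji.
Qed.

Lemma multilinear_unwords n G : multilinear (@unwords n G).
Proof.
apply/multilinearP => v i x y r Nv Nx Ny; rewrite !pr_unwords scaler_sumr -big_split.
apply: eq_bigr => w _ /=; rewrite !(prod_upd v (fun j => coef (tnth w j))) coef_linear.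
by rewrite mulrDl scalerDl -mulrA scalerA.
Qed.

Lemma words_unwords n G w : size w = n -> words (@unwords n G) w = G w.
Proof.
move=> /eqP sw; rewrite /words pr_unwords (bigD1 (Tuple sw)) //= [X in _ + X]big1 ?addr0.
  rewrite big1 ?scale1r // => i _.
  by rewrite /basis_args coef_Emat (tnth_nth l1) eqxx.
move=> u neq; suff [i ne] : exists i, tnth u i != nth l1 w i.
  rewrite (bigD1 i) //= /basis_args coef_Emat (negPf ne).
  by rewrite mul0r scale0r.
apply/existsP; apply: contraR neq; rewrite negb_exists => /forallP eq.
apply/eqP/eq_from_tnth => i; rewrite [RHS](tnth_nth l1); apply/eqP.
by have := eq i; rewrite negbK.
Qed.

Lemma words_sub n (f g : cochain R n) w :
  words (fun v => f v - g v) w = words f w - words g w.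
Proof. by rewrite /words raddfB. Qed.

Lemma cocycle_words n (f : cochain R n) : cocycle f ->
  forall w, size w = n.+1 -> wd (@qla R) (@qra R) (words f) w = 0.
Proof.
move=> [fl df] w sw; rewrite -words_hoch_d //; apply/inN_pr/df.
exact: allN_basis_args.
Qed.

(** A primitive restricts to words by [words] and extends back by [unwords]. In degree zero [wd] is
    0 on the empty word, in accordance with [coboundary]. *)
Lemma coboundaryP n (f : cochain R n) : multilinear f ->
  coboundary f <->
  exists H, forall w, size w = n -> words f w = wd (@qla R) (@qra R) H w.
Proof.
case: n f => [|n] f fl; split.
- move=> f0; exists (fun=> 0) => -[|//] _; apply/inN_pr/f0; exact: allN_basis_args.
- by move=> [H fH]; apply: multilinear_eq0 => // -[|//] _; rewrite fH.
- move=> [g [gl fg]]; exists (words g) => w sw; rewrite -words_hoch_d //.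
  by apply/inN_sub/fg; apply: allN_basis_args.
- move=> [H fH]; exists (@unwords n H); have Hl := @multilinear_unwords n H.
  split=> //; apply: multilinear_eq0 => [|w sw].
    exact: multilinearB (multilinear_hoch_d Hl).
  rewrite words_sub fH // words_hoch_d //; apply/eqP; rewrite subr_eq0; apply/eqP.
  by apply: eq_wd => u su; rewrite words_unwords // su sw.
Qed.

End Cochains.

(** * Koszul words and the dual cocycles *)

Definition kword n i : seq letter := nseq i ly ++ nseq (n - i) lx.

Lemma size_kword n i : (i <= n)%N -> size (kword n i) = n.
Proof. by move=> le_in; rewrite size_cat !size_nseq subnKC. Qed.

Lemma nth_kword n i k : (k < n)%N -> nth l1 (kword n i) k = if (k < i)%N then ly else lx.
Proof.
move=> lt_kn; rewrite nth_cat size_nseq !nth_nseq; case: ltnP => // le_ik.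
by have -> : (k - i < n - i)%N by lia.
Qed.

Lemma count_kword n i : count_mem ly (kword n i) = i.
Proof. by rewrite count_cat !count_nseq /= mul1n mul0n addn0. Qed.

Lemma kword_cons n i :
  kword n.+1 i = (if i == 0%N then lx else ly) :: kword n i.-1.
Proof. by case: i => [|i]; rewrite /kword ?subn0 //= subSS. Qed.

Lemma kword_rcons n i : (i <= n.+1)%N ->
  kword n.+1 i = rcons (kword n (minn i n)) (if (i <= n)%N then lx else ly).
Proof.
have nseqS k (a : letter) : nseq k.+1 a = rcons (nseq k a) a.
  by elim: k => //= k <-.
rewrite leq_eqVlt => /orP[/eqP->|]; last rewrite ltnS => le_in.
  by rewrite ltnn (minn_idPr (leqnSn n)) /kword !subnn !cats0 nseqS.
by rewrite le_in (minn_idPl le_in) /kword subSn // nseqS rcons_cat.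
Qed.

Lemma koszul_kword n i : koszul (kword n i).
Proof.
elim: i => [|i IH] in n *.
  rewrite /kword subn0 /=; elim: n => //= n; rewrite /koszul /= => /andP[-> IH].
  by case: n IH.
case: n => [|n]; first by rewrite /kword /= koszul_y; apply: (IH 0%N).
by rewrite kword_cons koszul_y; apply: IH.
Qed.

(** As xy is nonzero, no y can follow an x. *)
Lemma koszul_is_kword w : koszul w -> w = kword (size w) (count_mem ly w).
Proof.
elim: w => [//|a w IH] kaw; have wE := IH (koszul_cons kaw).
have cE b : count_mem ly (b :: w) = ((b == ly) + count_mem ly w)%N by [].
have [a_x|a_y] : a = lx \/ a = ly.
- by case: a kaw {cE} => [[] []] //; [left|right].
- have c0 : count_mem ly w = 0%N.
    case: w wE kaw {IH cE} => [//|b w].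
    rewrite [size _]/= kword_cons; case: eqP => // _ [-> _].
    by rewrite a_x /koszul /= andbF.
  by rewrite {1}wE cE a_x c0 kword_cons.
- by rewrite cE a_y eqxx add1n kword_cons -wE.
Qed.

Section Computation.
Variable R : comPzRingType.
Implicit Type D : 'rV[R]_5.
Local Notation d := (wd (@qla R) (@qra R)).

(** The Koszul differential: only the two outer terms survive. Deleting the first letter removes a y
    unless [i = 0], and deleting the last removes an x unless [i = n.+1]; hence [i.-1] and
    [minn i n]. *)
Lemma wd_kword n i (F : seq letter -> 'rV[R]_5) : (i <= n.+1)%N ->
  d F (kword n.+1 i) =
  qla (if i == 0%N then lx else ly) (F (kword n i.-1)) +
  (-1) ^+ n.+1 *: qra (if (i <= n)%N then lx else ly) (F (kword n (minn i n))).
Proof.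
move=> le_in; rewrite kword_cons /wd -kword_cons kword_rcons //; congr (_ + _).
rewrite inner_koszul -?kword_rcons ?koszul_kword //.
rewrite size_kword ?geq_minr // exprS mulN1r scaleNr -signr_odd.
by case: (odd n); rewrite /= ?expr1 ?expr0 ?scaleN1r ?opprK ?scale1r.
Qed.

Definition diagonal D := [/\ coord D 0 = 0, coord D 1 = 0 & coord D 2 = 0].

Definition dual n (w : seq letter) D : cochain R n :=
  fun v => (\prod_(k < n) coef (nth l1 w k) (v k)) *: sec D.
Arguments dual : clear implicits.

Lemma pr_dual n w D v :
  pr (dual n w D v) = (\prod_(k < n) coef (nth l1 w k) (v k)) *: D.
Proof. by rewrite linearZ /= prK. Qed.

Lemma multilinear_dual n w D : multilinear (dual n w D).
Proof.
apply/multilinearP => v i x y r Nv Nx Ny; rewrite !pr_dual.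
rewrite !(prod_upd v (fun j => coef (nth l1 w j))) coef_linear.
by rewrite mulrDl scalerDl -mulrA scalerA.
Qed.

(** Strictly upper triangular matrices lie in N, so N acts on diagonal classes through the
    augmentation [coef l1]. *)
Lemma pr_mul_diagonal D x : diagonal D -> inN x ->
  pr (x *m sec D) = coef l1 x *: D /\ pr (sec D *m x) = coef l1 x *: D.
Proof.
move=> [D0 D1 D2] /inNP[x10 x20 x21 x00 x11].
rewrite {2 4}(vec5_eta D) /pr !mulmx3E !secE x10 x20 x21 x11 -x00 D0 D1 D2 /coef /=.
split; apply/rowP => -[[|[|[|[|[|//]]]]] lt_k]; rewrite !mxE /=; ring.
Qed.

Lemma telescope_alternating n (T : nat -> R) :
  \sum_(k < n) (-1) ^+ k.+1 * (T k + T k.+1) = - T 0%N + (-1) ^+ n * T n.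
Proof.
elim: n => [|n IH]; first by rewrite big_ord0 expr0 mul1r addNr.
by rewrite big_ord_recr /= IH !exprS; ring.
Qed.

(* A letter x or y makes [coef] a derivation on N relative to the augmentation
   [coef l1]; so the product of such functionals is a cup product of 1-cocycles. *)
Lemma cocycle_dual n w D : diagonal D -> (forall k, (k < n)%N -> nth l1 w k \in [:: lx; ly]) ->
  cocycle (dual n w D).
Proof.
move=> dD gw; split=> [|v Nv]; first exact: multilinear_dual.
(* [A j] skips the argument [v_j], which enters [T j] through the augmentation. By the derivation
   rule the merge at [j] gives [T j + T j.+1], and the alternating sum telescopes to cancel the
   outer terms. *)
pose A j := \prod_(k < n) coef (nth l1 w k)
  (v (if (k < j)%N then widen_ord (leqnSn n) k else lift ord0 k)).
pose T j := coef l1 (v (inord j)) * A j.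
apply/inN_pr; rewrite pr_hoch_d.
have mergeE (j : 'I_n) : \prod_(k < n) coef (nth l1 w k) (merge v j k) = T j + T j.+1.
  have splitE (F : 'I_n -> R) : \prod_k F k = F j * \prod_(k < n | k != j) F k.
    exact: bigD1.
  rewrite /T /A !splitE ltnn ltnSn {1}/merge ltnn eqxx.
  set p := \prod_(k < n | k != j) coef _ (v _).
  rewrite [X in _ * X = _](_ : _ = p); last first.
    apply: eq_bigr => k ne_kj; congr (coef _ _); rewrite /merge.
    by case: ifP => // _; rewrite (negPf (ne_kj : k != j :> nat)).
  rewrite [X in _ = _ + _ * (_ * X)](_ : _ = p); last first.
    apply: eq_bigr => k ne_kj; rewrite ltnS leq_eqVlt.
    by rewrite (negPf (ne_kj : k != j :> nat)).
  have -> : inord j = widen_ord (leqnSn n) j.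
    by apply: val_inj; rewrite /= inordK // ltnW // ltnS.
  have -> : inord j.+1 = lift ord0 j :> 'I_n.+1.
    by apply: val_inj; rewrite /= inordK // ltnS.
  have /inNP[x10 x20 x21 x00 x11] := Nv (widen_ord (leqnSn n) j).
  have /inNP[y10 y20 y21 y00 y11] := Nv (lift ord0 j).
  have := gw _ (ltn_ord j); rewrite !inE => /orP[] /eqP ->; rewrite /coef /= !mulmx3E
    ?x10 ?x11 ?y21 ?y11 -?x00 -?y00; ring.
have T0 : pr (v ord0 *m dual n w D (fun j => v (lift ord0 j))) = T 0%N *: D.
  rewrite -scalemxAr linearZ /= (pr_mul_diagonal dD (Nv ord0)).1 scalerA mulrC /T /A.
  by congr ((coef _ (v _) * _) *: _); apply: val_inj; rewrite /= inordK.
have Tn : pr (dual n w D (fun j => v (widen_ord (leqnSn n) j)) *m v ord_max) = T n *: D.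
  rewrite -scalemxAl linearZ /= (pr_mul_diagonal dD (Nv ord_max)).2 scalerA mulrC /T /A.
  congr ((coef _ (v _) * _) *: _); first by apply: val_inj; rewrite /= inordK.
  by apply: eq_bigr => k _; rewrite ltn_ord.
rewrite T0 Tn; under eq_bigr => k _ do rewrite pr_dual mergeE scalerA.
rewrite -scaler_suml telescope_alternating scalerA -!scalerDl exprS.
by rewrite [X in X *: _](_ : _ = 0) ?scale0r //; ring.
Qed.

Lemma words_dual n i j D : (i <= n)%N -> (j <= n)%N ->
  words (dual n (kword n i) D) (kword n j) = (i == j)%:R *: D.
Proof.
move=> le_in le_jn; rewrite /words pr_dual; congr (_ *: _).
under eq_bigr => k _ do rewrite /basis_args coef_Emat !nth_kword //.
case: eqVneq => [->|ne_ij]; first by rewrite big1 // => k _; rewrite eqxx.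
(* Position [minn i j] is where the two Koszul words first differ. *)
have lt_k : (minn i j < n)%N by lia.
rewrite (bigD1 (Ordinal lt_k)) //=; move: (\prod_(k < n | _) _) => p.
have -> : (minn i j < i)%N = (j < i)%N by lia.
have -> : (minn i j < j)%N = (i < j)%N by lia.
by case: (ltngtP i j) ne_ij => //= _ _; rewrite ?ltnn ?mul0r.
Qed.

(** For positive [n], coboundaries at y^i x^(n-i) have as diagonal part the multiples of E11 +
    (-1)^n E22 if [i = 0], those of E22 if [0 < i < n], and those of a vector with E11-coefficient 1
    or -1 if [i = n]. So E11 survives, except E22 for [i = n]. The clause [i == 0] matters for
    [n = 0], where [i = 0, 1] must give E11 and E22. *)
Definition rep_value n i : 'rV[R]_5 :=
  if (i == 0)%N || (i < n)%N then vec5 0 0 0 1 0 else vec5 0 0 0 0 1.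

Definition rep n i : cochain R n := dual n (kword n i) (rep_value n i).
Arguments rep : clear implicits.

Lemma cocycle_rep n i : cocycle (rep n i).
Proof.
apply: cocycle_dual => [|k lt_kn].
  by rewrite /rep_value; case: ifP => _; split; rewrite coord_vec5.
by rewrite nth_kword //; case: ifP; rewrite !inE.
Qed.

Lemma words_sum n k (r : 'I_k -> R) (c : 'I_k -> cochain R n) w :
  words (fun v => \sum_(i < k) r i *: c i v) w = \sum_(i < k) r i *: words (c i) w.
Proof. by rewrite /words raddf_sum; apply: eq_bigr => i _ /=; rewrite linearZ. Qed.

End Computation.

Arguments dual : clear implicits.
Arguments rep : clear implicits.

(** * The Koszul complex of M/N *)

Section KoszulComplex.
Variable R : comPzRingType.
Local Notation d := (wd (@qla R) (@qra R)).

Lemma vec5D (p q s a b p' q' s' a' b' : R) :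
  vec5 p q s a b + vec5 p' q' s' a' b' = vec5 (p + p') (q + q') (s + s') (a + a') (b + b').
Proof. by apply/rowP => -[[|[|[|[|[|//]]]]] lt_k]; rewrite !mxE. Qed.

Lemma vec5Z (c p q s a b : R) :
  c *: vec5 p q s a b = vec5 (c * p) (c * q) (c * s) (c * a) (c * b).
Proof. by apply/rowP => -[[|[|[|[|[|//]]]]] lt_k]; rewrite !mxE. Qed.

Lemma vec5_inj (p q s a b p' q' s' a' b' : R) :
  vec5 p q s a b = vec5 p' q' s' a' b' -> [/\ p = p', q = q', s = s', a = a' & b = b'].
Proof.
move=> E; have Ek k := congr1 (fun v => coord v k) E.
by move: (Ek 0) (Ek 1) (Ek 2) (Ek 3) (Ek 4); rewrite !coord_vec5.
Qed.

Lemma vec5_0 : 0 = vec5 0 0 0 0 0 :> 'rV[R]_5.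
Proof. by apply/rowP => -[[|[|[|[|[|//]]]]] lt_k]; rewrite !mxE. Qed.

Lemma signP n : ((-1) ^+ n = 1 :> R) \/ ((-1) ^+ n = -1 :> R).
Proof. by rewrite -signr_odd; case: (odd n); [right|left]. Qed.

Lemma koszul_cocycle m (Z : seq letter -> 'rV[R]_5) :
  (forall i, (i <= m.+2)%N -> d Z (kword m.+2 i) = 0) ->
  exists r G, forall i, (i <= m.+1)%N ->
    Z (kword m.+1 i) = r i *: rep_value R m.+1 i + d G (kword m.+1 i).
Proof.
move=> dZ; pose z i := Z (kword m.+1 i); pose t : R := (-1) ^+ m.+1.
(* The cocycle equations leave the diagonal coordinates 3 and 4 free; they kill every coordinate 1
   and the extreme ones among 0 and 2, and tie coordinate 2 of [z i] to coordinate 0 of [z i.+1]. *)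
have p0 : coord (z 0) 0 = 0.
  move: (dZ 0%N isT); rewrite wd_kword //= min0n -/(z 0) !qlaE !qraE /=.
  by rewrite vec5Z vec5D vec5_0 => /vec5_inj[_ _ _ + _]; rewrite mulr0 addr0.
have q0 i : (i <= m.+1)%N -> coord (z i) 1 = 0.
  move=> le_im; move: (dZ i.+1 le_im); rewrite wd_kword //= -/(z i).
  by case: (i < m.+1)%N; rewrite qlaE qraE /= vec5Z vec5D vec5_0 => /vec5_inj[+ _ _ _ _];
    rewrite mulr0 addr0.
have sp i : (i <= m)%N -> coord (z i) 2 = t * coord (z i.+1) 0.
  move=> le_im; have le_i2 : (i.+1 <= m.+2)%N := leqW le_im.
  move: (dZ i.+1 le_i2); rewrite wd_kword // ltnS le_im (minn_idPl _) //.
  rewrite -/(z i) -/(z i.+1) qlaE qraE /=.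
  rewrite vec5Z vec5D vec5_0 exprS => /vec5_inj[_ _ _ _ /eqP].
  by rewrite mulN1r mulNr subr_eq0 => /eqP.
have sN : coord (z m.+1) 2 = 0.
  move: (dZ m.+2 (leqnn _)); rewrite wd_kword //= ltnn (minn_idPr _) // -/(z m.+1).
  rewrite qlaE qraE /= vec5Z vec5D vec5_0 => /vec5_inj[_ _ _ + _].
  by case: (signP m.+2) => ->; rewrite ?mul1r ?mulN1r add0r ?opprK // => /eqP;
    rewrite oppr_eq0 => /eqP.
pose s' := - t * coord (z m.+1) 3.
(* The E31-entry clears the E21- and E32-coordinates at once, by [sp]. The E21-entry at [j = 0]
   clears E22 at [i = 0]; the E32-entries clear E22 for [0 < i < m.+1], and [s'] clears E11 at
   [i = m.+1]. *)
pose g j := vec5 (if j == 0%N then t * coord (z 0) 4 else 0) (coord (z j.+1) 0)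
   (if (j < m)%N then coord (z j.+1) 4 else s') 0 0.
exists (fun i => if i == 0%N then coord (z 0) 3 - t * coord (z 0) 4 else
          if (i < m.+1)%N then coord (z i) 3 else coord (z m.+1) 4 - s' * (1 - t)).
exists (fun w => g (count_mem ly w)) => i le_im.
rewrite wd_kword // !count_kword -/(z i) -/t {1}(vec5_eta (z i)) q0 //.
have tt : t = 1 \/ t = -1 := signP _.
rewrite /rep_value qlaE qraE /g !coord_vec5 //= {}/g {}/s'.
case: (posnP i) => [->|i_gt0].
  rewrite min0n ltn0Sn leq0n /= !vec5Z !vec5D p0 sp //.
  by case: tt => ->; congr vec5; ring.
rewrite /=; case: (ltnP i m.+1) => [lt_im|ge_im].
  rewrite (minn_idPl _) // (gtn_eqF i_gt0) prednK // (lt_im : (i <= m)%N).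
  rewrite !vec5Z !vec5D sp //.
  by case: tt => ->; congr vec5; rewrite /=; ring.
have -> : i = m.+1 by lia.
rewrite ltnn /= (minn_idPr _) // ?ltnn sN !vec5Z !vec5D.
by case: tt => ->; congr vec5; rewrite /=; ring.
Qed.

(** Compare diagonal coordinates. At either end the coordinate missing from the representative
    forces the relevant entry of [G] to vanish; in between, a coboundary has no E11-part. *)
Lemma koszul_coboundary m r (G : seq letter -> 'rV[R]_5) :
  (forall i, (i <= m.+1)%N -> r i *: rep_value R m.+1 i = d G (kword m.+1 i)) ->
  forall i, (i <= m.+1)%N -> r i = 0.
Proof.
move=> rG i le_im; move: (rG i le_im); rewrite wd_kword // /rep_value qlaE qraE.
case: (posnP i) => [->|i_gt0].
  rewrite /= min0n !vec5Z !vec5D => /vec5_inj[_ _ _].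
  by case: (signP m.+1) => ->; rewrite ?mulr0 ?mulr1 ?addr0 ?add0r ?mul1r ?mulN1r => -> // /eqP;
   rewrite eq_sym ?oppr_eq0 => /eqP.
rewrite /=; case: (ltnP i m.+1) => [lt_im|ge_im].
  rewrite (lt_im : (i <= m)%N) /= !vec5Z !vec5D => /vec5_inj[_ _ _ + _].
  by rewrite mulr0 mulr1 addr0.
have -> : i = m.+1 by lia.
rewrite ltnn /= (minn_idPr _) // !vec5Z !vec5D => /vec5_inj[_ _ _ + +].
rewrite mulr0 mulr1 add0r.
case: (signP m.+1) => ->; rewrite ?mul1r ?mulN1r ?opprK => s0 ->; first by rewrite subrr.
by rewrite -s0 addr0.
Qed.

(** [acyclic] needs this on all words, Koszul or not. Absorbing [r i] into the diagonal value makes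
    each summand a cocycle by [cocycle_dual]. *)
Lemma wd_words_reps n (r : nat -> R) w : size w = n.+1 ->
  d (words (fun v => \sum_(i < n.+1) r i *: rep R n i v)) w = 0.
Proof.
move=> sw; pose c i := dual R n (kword n i) (r i *: rep_value R n i).
have cc (i : 'I_n.+1) : cocycle (c i).
  apply: cocycle_dual => [|k lt_kn]; last by rewrite nth_kword //; case: ifP; rewrite !inE.
  by rewrite /rep_value; case: ifP => _; rewrite vec5Z mulr0; split; rewrite coord_vec5.
have -> : d (words (fun v => \sum_(i < n.+1) r i *: rep R n i v)) w =
    d (fun u => \sum_(i < n.+1) words (c i) u) w.
  apply: eq_wd => u _; rewrite words_sum; apply: eq_bigr => i _.
  by rewrite /words !pr_dual !scalerA mulrC.
rewrite (wd_sum (quotient_bimodule R) _ (fun i => words (c i))) big1 // => i _.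
by rewrite (cocycle_words (cc i)).
Qed.

End KoszulComplex.

(** * Bases of the cohomology in degree zero and in positive degrees *)

Theorem theorem5p4 (R : comPzRingType) (n : nat) :
  HH_free_of_rank R n (if n == 0%N then 2%N else n.+1).
Proof.
have bQ := quotient_bimodule R; pose d := wd (@qla R) (@qra R).
exists (fun i => rep R n i); split; first by move=> i; apply: cocycle_rep.
have rl k (r : 'I_k -> R) : multilinear (fun v => \sum_(i < k) r i *: rep R n i v).
  by apply: multilinear_sum => i; apply: (cocycle_rep R n i).1.
case: n rl => [|m] rl.
  have repE (r : 'I_2 -> R) :
      words (fun v => \sum_(i < 2) r i *: rep R 0 i v) [::] =
      vec5 0 0 0 (r ord0) (r (lift ord0 ord0)).
    rewrite words_sum !big_ord_recl big_ord0 addr0 /words !pr_dual !big_ord0 !scale1r.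
    by rewrite /rep_value /= !vec5Z vec5D; congr vec5; ring.
  split=> [z cz|r].
    pose v := words z [::].
    exists (fun i => if i == ord0 then coord v 3 else coord v 4).
    apply/coboundaryP; first by apply: multilinearB => //; apply: cz.1.
    exists (fun=> 0) => -[|//] _; rewrite words_sub repE /=.
    have dz a : qla a v - qra a v = 0.
      have := cocycle_words cz (erefl (size [:: a])).
      by rewrite /wd inner1.
    rewrite -/v {1}(vec5_eta v).
    (* Commuting with x kills the E21- and E31-coordinates of [v], commuting with y the
       E32-coordinate; what remains is diagonal. *)
    have := dz lx; rewrite qlaE qraE /= -scaleN1r vec5Z vec5D vec5_0.
    case/vec5_inj=> _ _ + + _; rewrite mulr0 addr0 add0r mulN1r => /eqP.
    rewrite oppr_eq0 => /eqP -> ->.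
    have := dz ly; rewrite qlaE qraE /= -scaleN1r vec5Z vec5D vec5_0.
    case/vec5_inj=> _ _ _ + _; rewrite add0r mulN1r opprK => ->.
    by rewrite -vec5_0 subrr.
  move/(coboundaryP (rl _ _)) => [H /(_ [::] erefl)].
  rewrite repE [RHS]/= vec5_0 => /vec5_inj[_ _ _ r0 r1].
  case=> [[|[|//]] lt_i].
    by rewrite -r0; congr (r _); apply: val_inj.
  by rewrite -r1; congr (r _); apply: val_inj.
have repE (r : nat -> R) j : (j <= m.+1)%N ->
    words (fun v => \sum_(i < m.+2) r i *: rep R m.+1 i v) (kword m.+1 j) =
    r j *: rep_value R m.+1 j.
  move=> le_jm; rewrite words_sum (bigD1 (Ordinal (le_jm : j < m.+2)%N)) //= big1 => [|i ne_ij].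
    by rewrite addr0 words_dual // eqxx scale1r.
  rewrite words_dual -1?ltnS ?ltn_ord //.
  by rewrite (negPf (ne_ij : i != j :> nat)) scale0r scaler0.
split=> [z cz|r].
  have dz := cocycle_words cz.
  have [r [G zE]] := koszul_cocycle (fun i le_i => dz _ (size_kword le_i)).
  exists (fun i => r i); pose c v := \sum_(i < m.+2) r i *: rep R m.+1 i v.
  apply/coboundaryP; first by apply: multilinearB => //; apply: cz.1.
  (* By the choice of [r] and [G] this cocycle vanishes on Koszul words, so it has a primitive [h],
     and [h + G] is one for [z - c]. *)
  have [w sw|w sw kw|h fh] := acyclic (n := m.+1) (f := fun w => words z w - words c w - d G w) bQ.
  - rewrite !(wdB bQ) dz // wd_words_reps // subrr sub0r.
    by case: w sw => [|a [|b w]] // _; rewrite (wd_wd bQ) oppr0.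
  - rewrite (koszul_is_kword kw) sw.
    have le_c : (count_mem ly w <= m.+1)%N by rewrite -sw count_size.
    by rewrite zE // repE // addrAC addrK subrr.
  exists (fun w => h w + G w) => w sw.
  by rewrite words_sub (wdD bQ) -fh // subrK.
move/(coboundaryP (rl _ _)) => [H HE] i.
(* Coefficients are reindexed by naturals; the coboundary equation is then read on Koszul words. *)
have rE v : \sum_(i < m.+2) r i *: rep R m.+1 i v =
    \sum_(i < m.+2) r (inord i) *: rep R m.+1 i v.
  by apply: eq_bigr => j _; rewrite inord_val.
rewrite -(inord_val i); apply: (koszul_coboundary (m := m) (r := fun k => r (inord k)) (G := H)).
  move=> j le_jm; rewrite -[LHS](repE (fun k => r (inord k))) //.
  by apply: etrans (HE _ (size_kword le_jm)); rewrite /words -rE.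
exact: (ltn_ord i).
Qed.
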